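(* Let $S$ be an uncountable set. Then $\ell_\infty^{c,F}(S)$ does not admit an equivalent Gâteaux differentiable norm; that is, no norm on $\ell_\infty^{c,F}(S)$ equivalent to the supremum norm is Gâteaux differentiable at every nonzero point.
   Context: All spaces are real. For a set $S$, $\ell_\infty^c(S)$ is the Banach space of all bounded functions $x\colon S\to\mathbb{R}$ whose support $\{s\in S\colon x(s)\neq0\}$ is at most countable, with the supremum norm. $\ell_\infty^{c,F}(S)$ is its dense linear subspace of those functions that take only finitely many values. *)

(* Defs.v *)
From HB Require Import structures.
From mathcomp Require Import all_boot all_order all_algebra.
From mathcomp Require Import all_classical all_reals all_analysis.
Set Implicit Arguments.
Unset Strict Implicit.
Unset Printing Implicit Defensive.
Import Order.TTheory GRing.Theory Num.Theory.
Import numFieldNormedType.Exports.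
Local Open Scope classical_set_scope.
Local Open Scope ring_scope.

(* linfc R S is l_oo^c(S), linfcF R S is its subspace l_oo^{c,F}(S) *)
Section linfc.
Variables (R : realType) (S : Type).
Implicit Types x y : S -> R.

Definition bounded_countable_supp : {pred S -> R} :=
  mem [set x : S -> R | bounded_fun x /\ countable [set s | x s != 0]].

Lemma bounded_countable_suppP x : reflect
  ((exists M, forall s, `|x s| <= M) /\ countable [set s | x s != 0])
  (x \in bounded_countable_supp).
Proof.
apply: (iffP idP) => [|[[M xM] xc]]; rewrite inE /=.
  move=> [[M [_ xM]] xc]; split=> //.
  by exists (M + 1) => s; apply: xM => //; rewrite ltrDl.
split=> //; exists M; split; first exact: num_real.
by move=> N MN s _; exact: le_trans (xM s) (ltW MN).
Qed.

Fact bounded_countable_supp_submod_closed :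
  submod_closed bounded_countable_supp.
Proof.
split=> [|a x y].
  apply/bounded_countable_suppP; split; first by exists 0 => s; rewrite normr0.
  by apply: (sub_countable _ (@countable0 S)); apply: subset_card_le => s /=; rewrite eqxx.
move=> /bounded_countable_suppP[[M xM] xc] /bounded_countable_suppP[[N yN] yc].
apply/bounded_countable_suppP; split.
  exists (`|a| * M + N) => s.
  by rewrite (le_trans (ler_normD _ _))// lerD// normrM ler_wpM2l.
apply: (@sub_countable _ _ _ ([set s | x s != 0] `|` [set s | y s != 0])).
  apply: subset_card_le => s /=.
  have [xs0|? _] := eqVneq (x s) 0; last by left.
  have [ys0|? _] := eqVneq (y s) 0; last by right.
  by rewrite [X in X != _](_ : _ = a * x s + y s)// xs0 ys0 mulr0 addr0 eqxx.
by rewrite -bigcup2E; apply: bigcup_countable => // -[|[|i]] _ //=.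
Qed.

HB.instance Definition _ := GRing.isSubmodClosed.Build R (S -> R)
  bounded_countable_supp bounded_countable_supp_submod_closed.

Definition linfc : Type := {x : S -> R | x \in bounded_countable_supp}.

HB.instance Definition _ := [isSub of linfc for @sval _ _].
HB.instance Definition _ := [Choice of linfc by <:].
HB.instance Definition _ := [SubChoice_isSubLmodule of linfc by <:].

Definition linfc_fun (x : linfc) : S -> R := val x.
Coercion linfc_fun : linfc >-> Funclass.

(* for empty S this is sup set0 = 0, so it is a norm for every S *)
Definition sup_norm (x : linfc) : R := sup (range (fun s => `|x s|)).

Lemma sup_norm_ge (x : linfc) s : `|x s| <= sup_norm x.
Proof.
have /bounded_countable_suppP[[M xM] _] := valP x.
by apply: ub_le_sup; [exists M => _ [t _ <-]; exact: xM|exists s].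
Qed.

Lemma sup_norm_le (x : linfc) M :
  0 <= M -> (forall s, `|x s| <= M) -> sup_norm x <= M.
Proof.
move=> M0 xM; have [/set0P r0|] := boolP (range (fun s => `|x s|) != set0).
  by apply: ge_sup => // _ [t _ <-]; exact: xM.
by rewrite negbK /sup_norm => /eqP ->; rewrite sup0.
Qed.

Lemma sup_norm_ge0 (x : linfc) : 0 <= sup_norm x.
Proof.
have [/set0P[_ [s _ _]]|] := boolP (range (fun s => `|x s|) != set0).
  by rewrite (le_trans _ (sup_norm_ge x s)).
by rewrite negbK /sup_norm => /eqP ->; rewrite sup0.
Qed.

Fact ler_sup_normD (x y : linfc) : sup_norm (x + y) <= sup_norm x + sup_norm y.
Proof.
apply: sup_norm_le => [|s]; first by rewrite addr_ge0 ?sup_norm_ge0.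
by rewrite (le_trans (ler_normD _ _))// lerD ?sup_norm_ge.
Qed.

Fact sup_normZ (a : R) (x : linfc) : sup_norm (a *: x) = `|a| * sup_norm x.
Proof.
have le b (y : linfc) : sup_norm (b *: y) <= `|b| * sup_norm y.
  apply: sup_norm_le => [|s]; first by rewrite mulr_ge0 ?sup_norm_ge0.
  by rewrite [X in `|X|](_ : _ = b * y s)// normrM ler_wpM2l ?sup_norm_ge.
apply/eqP; rewrite eq_le le /=.
have [->|a0] := eqVneq a 0; first by rewrite normr0 mul0r sup_norm_ge0.
rewrite -ler_pdivlMl ?normr_gt0// -normfV.
by rewrite -{1}[x](scalerK a0) le.
Qed.

Fact sup_norm0_eq0 (x : linfc) : sup_norm x = 0 -> x = 0.
Proof.
move=> x0; apply/val_inj/funext => s; apply/eqP.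
by rewrite -normr_le0 -x0; exact: sup_norm_ge.
Qed.

HB.instance Definition _ :=
  @Lmodule_isNormed.Build R linfc sup_norm ler_sup_normD sup_normZ sup_norm0_eq0.

End linfc.
Arguments bounded_countable_supp {R S}.

Section linfcF.
Variables (R : realType) (S : Type).

Definition finitely_valued : {pred linfc R S} :=
  mem [set x : linfc R S | finite_set (range x)].

Fact finitely_valued_submod_closed : submod_closed finitely_valued.
Proof.
split=> [|a x y]; rewrite !inE /=.
  by apply: (sub_finite_set _ (finite_set1 (0 : R))) => _ [s _ <-].
by move=> fx fy; exact: (finite_image11 (fun u v => a * u + v)).
Qed.

HB.instance Definition _ := GRing.isSubmodClosed.Build R (linfc R S)
  finitely_valued finitely_valued_submod_closed.

Definition linfcF : Type := {x : linfc R S | x \in finitely_valued}.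

HB.instance Definition _ := [isSub of linfcF for @sval _ _].
HB.instance Definition _ := [Choice of linfcF by <:].
HB.instance Definition _ := [SubChoice_isSubLmodule of linfcF by <:].

Definition linfc_of_linfcF (x : linfcF) : linfc R S := val x.
Coercion linfc_of_linfcF : linfcF >-> linfc.

Definition linfcF_norm (x : linfcF) : R := `|x : linfc R S|.

Fact ler_linfcF_normD (x y : linfcF) :
  linfcF_norm (x + y) <= linfcF_norm x + linfcF_norm y.
Proof. exact: ler_normD. Qed.

Fact linfcF_normZ (a : R) (x : linfcF) :
  linfcF_norm (a *: x) = `|a| * linfcF_norm x.
Proof. exact: normrZ. Qed.

Fact linfcF_norm0_eq0 (x : linfcF) : linfcF_norm x = 0 -> x = 0.
Proof. by move=> /normr0_eq0 x0; exact/val_inj. Qed.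

HB.instance Definition _ := @Lmodule_isNormed.Build R linfcF
  linfcF_norm ler_linfcF_normD linfcF_normZ linfcF_norm0_eq0.

End linfcF.
Arguments finitely_valued {R S}.

Definition is_norm (R : realType) (V : lmodType R) (N : V -> R) : Prop :=
  [/\ forall x y, N (x + y) <= N x + N y,
      forall (a : R) x, N (a *: x) = `|a| * N x &
      forall x, N x = 0 -> x = 0].

Definition equivalent_norms (R : realType) (V : lmodType R) (N1 N2 : V -> R)
    : Prop :=
  exists c C : R, [/\ 0 < c, 0 < C & forall x, c * N1 x <= N2 x <= C * N1 x].

(* The norm of V only enters through the continuity of l, hence replacing it by
   an equivalent one does not change the notion. *)
Definition gateaux_differentiable (R : realType) (V : normedModType R)
    (f : V -> R) (x : V) : Prop :=
  exists2 l : {linear V -> R^o},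
    continuous l & forall h, is_derive x h (f : V -> R^o) (l h).

(* Main.v *)
Require Import Defs.
From HB Require Import structures.
From mathcomp Require Import all_boot all_order all_algebra.
From mathcomp Require Import all_classical all_reals all_analysis.
From mathcomp Require Import ring lra.
Set Implicit Arguments.
Unset Strict Implicit.
Unset Printing Implicit Defensive.
Import Order.TTheory GRing.Theory Num.Theory.
Import numFieldNormedType.Exports.
Local Open Scope classical_set_scope.
Local Open Scope ring_scope.

(** Write [K] for the functions with values in {-1, 0, 1}. The supremum of [N]
    over the elements of [K] vanishing on a countable set [A] decreases with
    [A], hence is constant, say equal to [m], once [A] contains a suitable
    countable set [A0]. Below, everything vanishes on [A0]. If [v] and [w] are
    disjoint elements of [K] then [2 N v <= N (v + w) + N (v - w)], so
    [N v > m - e] forces [N (v + w) > m - 2 e]. Gluing disjoint [v_n] with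
    [N v_n --> m] therefore gives [x] in [K] with [N x = m], and a disjoint [y]
    with [N y = m] is found in the same way. Then
    [N (x + t y) = m * max(1, |t|)], which is not differentiable at [t = 1]. *)

Lemma countable_union (T : Type) (A B : set T) :
  countable A -> countable B -> countable (A `|` B).
Proof.
by move=> Ac Bc; rewrite -bigcup2E; apply: bigcup_countable => // -[|[|i]] _ //=.
Qed.

(** * Convexity of a norm and failure of differentiability at a corner *)

Section norm.
Variables (R : realType) (V : lmodType R) (N : V -> R).
Hypothesis N_norm : is_norm N.
Implicit Types x y : V.

Lemma is_normD x y : N (x + y) <= N x + N y. Proof. by case: N_norm. Qed.

Lemma is_normZ (a : R) x : N (a *: x) = `|a| * N x. Proof. by case: N_norm. Qed.

Lemma is_norm0 : N 0 = 0.
Proof. by rewrite -(scale0r (0 : V)) is_normZ normr0 mul0r. Qed.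

Lemma is_normN x : N (- x) = N x.
Proof. by rewrite -scaleN1r is_normZ normrN1 mul1r. Qed.

Lemma is_norm_midpoint x y : 2 * N x <= N (x + y) + N (x - y).
Proof.
apply: le_trans (is_normD _ _).
have -> : x + y + (x - y) = 2 *: x by rewrite addrACA subrr addr0 scaler_nat.
by rewrite is_normZ ger0_norm.
Qed.

(** Convexity bounds [N] by [m] on the whole segment from [x - y] to [x + y]; since the midpoint [x]
    of [x - t *: y] and [x + t *: y] already has norm [m], neither end can fall below [m]. *)
Lemma is_norm_flat (m : R) x y t : N x = m -> N (x + y) <= m ->
  N (x - y) <= m -> `|t| <= 1 -> N (x + t *: y) = m.
Proof.
move=> xm xDy xBy.
have le_m u : `|u| <= 1 -> N (x + u *: y) <= m.
  rewrite ler_norml => /andP[u1 u2].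
  have -> : x + u *: y = ((1 + u) / 2) *: (x + y) + ((1 - u) / 2) *: (x - y).
    rewrite !scalerDr !scalerN addrACA -scalerBl -scalerDl.
    have -> : (1 + u) / 2 + (1 - u) / 2 = 1 by field.
    have -> : (1 + u) / 2 - (1 - u) / 2 = u by field.
    by rewrite scale1r.
  apply: le_trans (is_normD _ _) _.
  rewrite !is_normZ !ger0_norm; [|lra|lra].
  have := ler_wpM2l (_ : 0 <= (1 + u) / 2) xDy.
  have := ler_wpM2l (_ : 0 <= (1 - u) / 2) xBy.
  move=> /(_ ltac:(lra)) h1 /(_ ltac:(lra)) h2.
  by apply: le_trans (lerD h2 h1) _; lra.
move=> t1; apply/eqP; rewrite eq_le le_m//=.
have := is_norm_midpoint x (t *: y); rewrite xm -scaleNr.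
by have := le_m (- t); rewrite normrN => /(_ t1); lra.
Qed.

End norm.

(** At [x + y] in direction [y], the right difference quotients equal [m] and the left ones, for
    steps of length at most 1, equal 0. *)
Lemma is_norm_not_gateaux (R : realType) (V : normedModType R) (N : V -> R)
    (m : R) (x y : V) : is_norm N -> 0 < m -> N x = m -> N y = m ->
  N (x + y) <= m -> N (x - y) <= m -> ~ gateaux_differentiable N (x + y).
Proof.
move=> N_norm m0 xm ym xDy xBy [l _ /(_ y)[+ _]].
have yDx : N (y + x) <= m by rewrite addrC.
have yBx : N (y - x) <= m by rewrite -opprB is_normN.
have right h : 0 < h -> N (h *: y + (x + y)) = (1 + h) * m.
  move=> h0.
  (* Factoring out [1 + h] leaves a coefficient of [x] below 1, so flatness applies with [x] and [y]
     exchanged. *)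
  have -> : h *: y + (x + y) = (1 + h) *: (y + (1 + h)^-1 *: x).
    rewrite scalerDr scalerA divff ?scale1r; last by lra.
    by rewrite scalerDl scale1r addrCA addrC [_ *: _ + y]addrC.
  rewrite is_normZ// ger0_norm; last by lra.
  rewrite (@is_norm_flat _ _ _ _ m)// ger0_norm ?invr_ge0; last by lra.
  by rewrite invf_le1; lra.
have left h : 0 < h -> h <= 1 -> N ((- h) *: y + (x + y)) = m.
  move=> h0 h1.
  have -> : (- h) *: y + (x + y) = x + (1 - h) *: y.
    by rewrite scalerDl scale1r addrCA [_ + y]addrC.
  by rewrite (@is_norm_flat _ _ _ _ m)// ger0_norm; lra.
(* Quotients [m] and 0 cannot both lie within less than [m / 2] of one limit [d]. *)
rewrite /derivable => /cvg_ex[/= d /cvgrPdist_lt/(_ (m / 2))].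
rewrite divr_gt0// => /(_ isT)[e /= e0 dball].
(* [h < e] puts both [h] and [- h] in the ball; [h <= 1] is required by [left]. *)
pose h := Num.min (e / 2) 1.
have h0 : 0 < h by rewrite lt_min; lra.
have h1 : h <= 1 by rewrite ge_min lexx orbT.
have he : h < e by rewrite gt_min; apply/orP; left; lra.
have Nxy : N (x + y) = m.
  by rewrite -[y]scale1r (@is_norm_flat _ _ _ _ m)// normr1.
have := dball h; rewrite /ball_ /= sub0r normrN gtr0_norm// right// Nxy.
have := dball (- h); rewrite /ball_ /= sub0r opprK gtr0_norm// left// Nxy.
rewrite subrr scaler0 subr0 oppr_eq0 gt_eqF// => /(_ he isT) dl.
move=> /(_ he isT); rewrite [_ *: _](_ : _ = m); last first.
  by rewrite /GRing.scale /=; field; rewrite gt_eqF.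
move: dl; rewrite !ltr_norml => /andP[d1 d2] /andP[d3 d4].
by lra.
Qed.

(** * Functions with values in {-1, 0, 1} and their disjoint sums *)

Section sign_valued.
Variables (R : realType) (S : Type).
Implicit Types (A B : set S) (x y v w : linfcF R S).

Definition sign_value (r : R) : Prop := [\/ r = 0, r = 1 | r = - 1].

Definition sign_valued_off A : set (linfcF R S) :=
  [set x | (forall s, sign_value (x s)) /\ forall s, A s -> x s = 0].

Lemma sign_valued_off_sub A B : A `<=` B ->
  sign_valued_off B `<=` sign_valued_off A.
Proof. by move=> AB x [xK x0]; split=> // s /AB/x0. Qed.

Lemma linfcF_addE x y s : (x + y : linfcF R S) s = x s + y s. Proof. by []. Qed.

Lemma linfcF_oppE x s : (- x : linfcF R S) s = - x s. Proof. by []. Qed.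

Lemma linfcF_supp_countable x : countable [set s | x s != 0].
Proof.
by have /bounded_countable_suppP[] := valP (x : linfc R S).
Qed.

Lemma sign_value_exists (f : S -> R) : (forall s, sign_value (f s)) ->
  countable [set s | f s != 0] -> exists x, forall s, x s = f s.
Proof.
move=> fK fc.
have fb : f \in @bounded_countable_supp R S.
  apply/bounded_countable_suppP; split=> //; exists 1 => s.
  by case: (fK s) => ->; rewrite ?normr0 ?normrN ?normr1.
have fF : (exist _ f fb : linfc R S) \in finitely_valued.
  rewrite inE /=.
  apply: (@sub_finite_set _ _ [set 0; 1; - 1]); last first.
    by rewrite !finite_setU; do !split; exact: finite_set1.
  by move=> _ [s _ <-]; case: (fK s) => e; rewrite /linfc_fun /= e;
    [left; left|left; right|right].
by exists (exist (fun x : linfc R S => x \in finitely_valued) _ fF).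
Qed.

Lemma sign_valued_offD A x y : sign_valued_off A x ->
  sign_valued_off (A `|` [set s | x s != 0]) y -> sign_valued_off A (x + y).
Proof.
move=> [xK x0] [yK y0]; split=> s.
  rewrite linfcF_addE; have [->|xs] := eqVneq (x s) 0; first by rewrite add0r.
  by rewrite y0 ?addr0//; right.
by move=> As; rewrite linfcF_addE x0// y0 ?addr0//; left.
Qed.

Lemma sign_valued_offN A x : sign_valued_off A x -> sign_valued_off A (- x).
Proof.
move=> [xK x0]; split=> s; rewrite linfcF_oppE; last by move=> /x0 ->; rewrite oppr0.
by case: (xK s) => ->; rewrite ?oppr0 ?opprK; [constructor 1|constructor 3|constructor 2].
Qed.

(** The pointwise sum stays in the space: its support lies in a countable union of countable sets,
    and disjointness creates no new values. The second conclusion makes [v n] and [x - v n]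
    disjoint, as the midpoint inequality will need. *)
Lemma sign_valued_glue A (v : nat -> linfcF R S) :
  (forall n, sign_valued_off A (v n)) ->
  (forall i j s, v i s != 0 -> v j s != 0 -> i = j) ->
  exists2 x, sign_valued_off A x &
    forall n, sign_valued_off (A `|` [set s | v n s != 0]) (x - v n).
Proof.
move=> vA vI.
(* The default index 0 is harmless: it is only used where every [v n s] is 0. *)
pose f s := v (xget 0%N [set n | v n s != 0]) s.
have fE n s : v n s != 0 -> f s = v n s.
  move=> vns; rewrite /f; case: xgetP => [k _ vks|/(_ n)//].
  by rewrite (vI k n s).
have f0 s : (forall n, v n s = 0) -> f s = 0 by move=> v0; exact: v0.
have [x xE] : exists x, forall s, x s = f s.
  apply: sign_value_exists => [s|]; first by have [vK _] := vA (xget 0%N [set n | v n s != 0]); exact: vK.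
  apply: (@sub_countable _ _ _ (\bigcup_n [set s | v n s != 0])).
    by apply: subset_card_le => s /= fs; exists (xget 0%N [set n | v n s != 0]).
  by apply: bigcup_countable => // n _; exact: linfcF_supp_countable.
have xK : sign_valued_off A x.
  split=> s; rewrite xE; first by have [vK _] := vA (xget 0%N [set n | v n s != 0]); exact: vK.
  by move=> As; apply: f0 => n; case: (vA n) => _; exact.
exists x => // n; have [xK1 xA] := xK; have [vK1 vnA] := vA n.
split=> s; rewrite linfcF_addE linfcF_oppE.
  have [->|vs] := eqVneq (v n s) 0; first by rewrite subr0.
  by rewrite xE (fE n)// subrr; constructor 1.
by move=> [As|/= vs]; [rewrite xA// vnA// subrr|rewrite xE (fE n)// subrr].
Qed.

(** Greedy choice: finitely many earlier supports together with [A] still form a countable set, off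
    which the next function can be chosen. *)
Lemma sign_valued_disjoint_sequence A (P : nat -> set (linfcF R S)) :
  countable A ->
  (forall B n, countable B -> A `<=` B -> exists2 v, sign_valued_off B v & P n v) ->
  exists v : nat -> linfcF R S, [/\ forall n, sign_valued_off A (v n),
    forall n, P n (v n) & forall i j s, v i s != 0 -> v j s != 0 -> i = j].
Proof.
move=> Ac vP.
(* Placing the conditions on the set inside the conclusion makes [g] total; where they fail, 0
   serves as a value. *)
have /choice[g gP] : forall Bn : set S * nat, exists v, countable Bn.1 ->
    A `<=` Bn.1 -> sign_valued_off Bn.1 v /\ P Bn.2 v.
  move=> [B n]; have [[Bc AB]|nB] := pselect (countable B /\ A `<=` B).
    by have [v ? ?] := vP B n Bc AB; exists v.
  by exists 0 => /= Bc AB; case: nB.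
pose B := fix B n := if n is k.+1 then
  B k `|` [set s | g (B k, k) s != 0] else A.
have BP n : countable (B n) /\ A `<=` B n.
  elim: n => [|n [Bc AB]]; first by split=> //; exact: subset_refl.
  split; last by move=> s /AB; left.
  by apply: countable_union => //; exact: linfcF_supp_countable.
have Bmono i j : (i <= j)%N -> B i `<=` B j.
  move=> /subnK <-; elim: (j - i)%N => [//|k IH] s Bs.
  by rewrite addSn; left; exact: IH.
have gBP n : sign_valued_off (B n) (g (B n, n)) /\ P n (g (B n, n)).
  by have [Bc AB] := BP n; exact: (gP (B n, n)).
have disj i j s : (i < j)%N -> g (B i, i) s != 0 -> g (B j, j) s = 0.
  move=> ij gi; have [[_ g0] _] := gBP j; apply: g0.
  by apply: (Bmono _ _ ij); right.
exists (fun n => g (B n, n)); split=> [n|n|i j s gi gj].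
- by have [_ AB] := BP n; have [+ _] := gBP n; exact: sign_valued_off_sub.
- by have [] := gBP n.
- have [ij|ji|//] := ltngtP i j.
  + by move: gj; rewrite (disj i j)// eqxx.
  + by move: gi; rewrite (disj j i)// eqxx.
Qed.

End sign_valued.

(** * The stable supremum off countable sets and its attainment *)

Section stable_supremum.
Variables (R : realType) (S : Type) (N : linfcF R S -> R) (C : R).
Hypothesis N_norm : is_norm N.
Hypothesis NC : forall x, sign_valued_off set0 x -> N x <= C.
Local Notation K := (@sign_valued_off R S).

(** [m] is the infimum, over countable [A], of the supremum of [N] on [K A]. A minimizing sequence
    [A_] has a countable union [A0], which attains this infimum. *)
Lemma stable_supremum : exists (A0 : set S) (m : R),
  [/\ countable A0, forall x, K A0 x -> N x <= m &
      forall B (e : R), countable B -> A0 `<=` B -> 0 < e ->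
        exists2 x, K B x & m - e < N x].
Proof.
pose sup_off A := sup (N @` K A).
have K0 A : K A 0 by split=> s //; constructor 1.
have hs A : has_sup (N @` K A).
  split; first by exists (N 0), 0.
  exists C => _ [x xA <-]; apply: NC; exact: sign_valued_off_sub xA.
have sup_off_mono A B : A `<=` B -> sup_off B <= sup_off A.
  move=> AB; apply: ge_sup; first by case: (hs B).
  move=> _ [x xB <-]; apply: ub_le_sup; first by case: (hs A).
  by exists x => //; exact: sign_valued_off_sub xB.
have hi : has_inf (sup_off @` [set A | countable A]).
  split; first by exists (sup_off set0), set0 => //; exact: countable0.
  exists 0 => _ [A _ <-]; rewrite -(is_norm0 N_norm).
  by apply: ub_le_sup; [case: (hs A)|exists 0].
pose m := inf (sup_off @` [set A | countable A]).
have /choice[A_ A_P] : forall n : nat, exists A, countable A /\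
    sup_off A < m + n.+1%:R^-1.
  move=> n; have := inf_adherent (_ : 0 < n.+1%:R^-1 :> R) hi.
  by rewrite invr_gt0 ltr0n => /(_ isT)[_ [A Ac <-] ?]; exists A.
pose A0 := \bigcup_n A_ n.
have A0c : countable A0.
  by apply: bigcup_countable => // n _; have [] := A_P n.
have m_le B : countable B -> m <= sup_off B.
  by move=> Bc; apply: ge_inf; [case: hi|exists B].
exists A0, m; split=> // [x xA0|B e Bc AB e0]; last first.
  have [_ [x xB <-]] := sup_adherent e0 (hs B).
  by move=> lt; exists x => //; apply: le_lt_trans lt; rewrite lerD2r m_le.
apply/ler_addgt0Pr => e e0.
have [n ne] : exists n : nat, n.+1%:R^-1 < e.
  by have [n _ nP] := near_infty_natSinv_lt (PosNum e0); exists n; apply: nP => /=.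
apply: (@le_trans _ _ (sup_off (A_ n))); last first.
  by have [_ /ltW/le_trans] := A_P n; apply; rewrite lerD2l ltW.
apply: ub_le_sup; first by case: (hs (A_ n)).
by exists x => //; apply: sign_valued_off_sub xA0 => s; exists n.
Qed.

(** The freedom in [B] permits a second use that avoids the support of the function found first. *)
Lemma stable_supremum_attained (A0 : set S) (m : R) :
  countable A0 -> (forall x, K A0 x -> N x <= m) ->
  (forall B (e : R), countable B -> A0 `<=` B -> 0 < e ->
     exists2 x, K B x & m - e < N x) ->
  forall B, countable B -> A0 `<=` B -> exists2 x, K B x & N x = m.
Proof.
move=> A0c Nm mN B Bc AB.
have [|v [vB vN vI]] := @sign_valued_disjoint_sequence R S B
    (fun n => [set v | m - n.+1%:R^-1 < N v]) Bc.
  move=> D n Dc BD; apply: mN => //.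
  exact: subset_trans BD.
have [x xB xv] := sign_valued_glue vB vI.
have A0K := sign_valued_off_sub AB.
exists x => //; apply/eqP; rewrite eq_le Nm/=; last exact: A0K.
apply/ler_addgt0Pr => e e0.
(* Half of [e], because the midpoint inequality doubles the defect of [N (v n)]. *)
have [n ne] : exists n : nat, n.+1%:R^-1 < e / 2.
  have e20 : 0 < e / 2 by rewrite divr_gt0.
  by have [n _ nP] := near_infty_natSinv_lt (PosNum e20); exists n; apply: nP => /=.
have Nd : N (v n - (x - v n)) <= m.
  apply/Nm/A0K/sign_valued_offD; first exact: vB.
  exact/sign_valued_offN/xv.
have := is_norm_midpoint N_norm (v n) (x - v n); rewrite [_ + (x - _)]addrC subrK.
move=> /le_trans/(_ (lerD (lexx _) Nd)).
have /= := vN n; move: (n.+1%:R^-1) ne => k; lra.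
Qed.

End stable_supremum.

(** * Contradiction from two disjoint functions of norm [m] *)

Theorem corollary5p2 (R : realType) (S : Type)
    (uncountable_S : ~ countable [set: S]) :
  ~ exists N : linfcF R S -> R,
      [/\ is_norm N,
          equivalent_norms (fun x : linfcF R S => `|x|) N &
          forall x : linfcF R S, x != 0 -> gateaux_differentiable N x].
Proof.
move=> [N [N_norm [c [C [c0 C0 cNC]]] N_diff]].
have NC (x : linfcF R S) : sign_valued_off set0 x -> N x <= C.
  move=> [xK _]; have /andP[_ /le_trans] := cNC x; apply.
  rewrite ger_pMr//; apply: sup_norm_le => // s.
  by case: (xK s) => ->; rewrite ?normr0 ?normrN ?normr1.
have [A0 [m [A0c Nm mN]]] := stable_supremum N_norm NC.
have attained := stable_supremum_attained N_norm A0c Nm mN.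
(* Uncountability leaves a point [s0] outside [A0]; its indicator lies in [K A0] and has positive
   norm. *)
have m0 : 0 < m.
  have [s0 A0s] : exists s, ~ A0 s.
    apply/existsNP => A0T; apply: uncountable_S.
    by apply: sub_countable A0c; apply: subset_card_le => s _; exact: A0T.
  pose f s : R := if `[< s = s0 >] then 1 else 0.
  have [s||e eE] := @sign_value_exists R S f.
  - by rewrite /f; case: ifP => _; [constructor 2|constructor 1].
  - apply: sub_countable (countable1 s0); apply: subset_card_le => s /=.
    by rewrite /f; case: asboolP => // _; rewrite eqxx.
  have eK : sign_valued_off A0 e.
    split=> s; rewrite eE /f; case: asboolP => //.
    + by constructor 2.
    + by constructor 1.
    + by move=> ->.
  apply: lt_le_trans (Nm _ eK).
  have /andP[+ _] := cNC e; apply: lt_le_trans; rewrite mulr_gt0// normr_gt0.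
  apply/eqP => e0; have := eE s0; rewrite e0 /f asboolT// => /esym/eqP.
  by rewrite [X in _ == X](_ : _ = 0)// oner_eq0.
have [x xA xm] := attained _ A0c (@subset_refl _ _).
(* Adding the support of [x] to the excluded set makes [y] disjoint from [x]. *)
have [||y yA ym] := attained (A0 `|` [set s | x s != 0]).
- exact/countable_union/linfcF_supp_countable.
- by move=> s; left.
have xDy : N (x + y) <= m by apply/Nm/sign_valued_offD.
have xBy : N (x - y) <= m by apply/Nm/sign_valued_offD => //; exact: sign_valued_offN.
apply: (is_norm_not_gateaux N_norm m0 xm ym xDy xBy).
(* If [x + y] were 0, the midpoint inequality would give [2 * m <= N (x - y) <= m]. *)
apply: N_diff; apply/eqP => xy0.
have := is_norm_midpoint N_norm x y.
rewrite xy0 (is_norm0 N_norm) xm; lra.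
Qed.
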